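(* Let $\mathcal{R}:\mathbb{R}^{n(mN+k)}\to\tilde X_\pi$ be the representation map, and let $\mathcal{U}$ and $\hat{\mathcal{U}}$ be the associated matrices defined in the context. Let $\sigma_{\min}(\mathcal{U})$, $\sigma_{\max}(\mathcal{U})$ denote the minimal and maximal singular values of $\mathcal{U}$, and let $\sigma_{\min}(\hat{\mathcal{U}})$, $\sigma_{\max}(\hat{\mathcal{U}})$ denote the minimal and maximal singular values of $\hat{\mathcal{U}}$. Then \[ \|\mathcal{R}\|_{\mathbb{R}^{n(mN+k)}\to L^2}=\sigma_{\max}(\mathcal{U}),\qquad \|\mathcal{R}^{-1}\|_{L^2\to\mathbb{R}^{n(mN+k)}}=\sigma_{\min}(\mathcal{U})^{-1}, \] \[ \|\mathcal{R}\|_{\mathbb{R}^{n(mN+k)}\to H^1_{D,\pi}}=\sigma_{\max}(\hat{\mathcal{U}}),\qquad \|\mathcal{R}^{-1}\|_{H^1_{D,\pi}\to\mathbb{R}^{n(mN+k)}}=\sigma_{\min}(\hat{\mathcal{U}})^{-1}. \]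
   Context: Let $[a,b]\subset\mathbb{R}$ be a compact interval, $k<m$ positive integers, $N\ge1$ an integer, and $\pi: a=t_0<t_1<\dots<t_n=b$ a partition with stepsizes $h_j=t_j-t_{j-1}$. $\mathfrak{P}_K$ is the set of real polynomials of degree at most $K$. $\tilde X_\pi$ is the space of functions $x=(x_1,\dots,x_m):[a,b]\to\mathbb{R}^m$, piecewise continuous with breakpoints only at mesh points, such that on every $[t_{j-1},t_j)$ the component $x_\kappa$ coincides with a polynomial in $\mathfrak{P}_N$ for $\kappa=1,\dots,k$ and in $\mathfrak{P}_{N-1}$ for $\kappa=k+1,\dots,m$. The polynomial piece of $x_\kappa$ on the $j$-th subinterval is denoted $x_{j\kappa}$ (functions are identified with their collections of polynomial pieces). Basis and representation map: let $\{p_0,\dots,p_{N-1}\}$ be a basis of $\mathfrak{P}_{N-1}$ (on $[0,1]$), and let $\bar p_0(\tau)=1$, $\bar p_i(\tau)=\int_0^\tau p_{i-1}(\sigma)\,d\sigma$, $i=1,\dots,N$. Put $p_{ji}(t)=p_i((t-t_{j-1})/h_j)$ and $\bar p_{ji}(t)=h_j\,\bar p_i((t-t_{j-1})/h_j)$. A coefficient vector $c=(c_1,\dots,c_n)\in\mathbb{R}^{n(mN+k)}$ has blocks $c_j=(c_{j1},\dots,c_{jm})\in\mathbb{R}^{mN+k}$ with $c_{j\kappa}=(c_{j\kappa0},\dots,c_{j\kappa N})\in\mathbb{R}^{N+1}$ for $\kappa\le k$ and $c_{j\kappa}=(c_{j\kappa0},\dots,c_{j\kappa,N-1})\in\mathbb{R}^{N}$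 for $\kappa>k$. The representation map $\mathcal{R}:\mathbb{R}^{n(mN+k)}\to\tilde X_\pi$ is the linear bijection $x=\mathcal{R}c$ given by $x_{j\kappa}=\sum_{l=0}^N c_{j\kappa l}\bar p_{jl}$ for $\kappa\le k$ and $x_{j\kappa}=\sum_{l=0}^{N-1}c_{j\kappa l}p_{jl}$ for $\kappa>k$. Norms: $\mathbb{R}^{n(mN+k)}$ carries the Euclidean norm; on $\tilde X_\pi$, $\|x\|_{L^2}^2=\sum_{j=1}^n\sum_{\kappa=1}^m\int_{t_{j-1}}^{t_j}|x_{j\kappa}(t)|^2dt$ and $\|x\|_{H^1_{D,\pi}}^2=\sum_{j=1}^n\big\{\sum_{\kappa=1}^k\int_{t_{j-1}}^{t_j}(|x_{j\kappa}(t)|^2+|x_{j\kappa}'(t)|^2)dt+\sum_{\kappa=k+1}^m\int_{t_{j-1}}^{t_j}|x_{j\kappa}(t)|^2dt\big\}$. The operator norms are taken with respect to these norms. Matrices: choose nodes $0\le\bar\sigma_1<\dots<\bar\sigma_{N+1}\le1$ and $0\le\sigma_1<\dots<\sigma_N\le1$ such that there are quadrature formulae $\int_0^1 f\approx\sum_{i=1}^{N+1}\bar\gamma_i f(\bar\sigma_i)$ and $\int_0^1 f\approx\sum_{i=1}^{N}\gamma_i f(\sigma_i)$ with positive weights that are exact for polynomials of degree up to $2N$ and $2N-2$, respectively. Let $\bar V=(\bar p_{l}(\bar\sigma_i))_{i=1..N+1,\,l=0..N}$, $V=(p_l(\sigma_i))_{i=1..N,\,l=0..N-1}$, $\mathring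 V=(\bar p_l'(\bar\sigma_i))_{i=1..N+1,\,l=0..N}$, $\bar\Gamma=\mathrm{diag}(\bar\gamma_1^{1/2},\dots,\bar\gamma_{N+1}^{1/2})$, $\Gamma=\mathrm{diag}(\gamma_1^{1/2},\dots,\gamma_N^{1/2})$. Then $\mathcal{U}=\mathrm{diag}(U_1,\dots,U_n)$ and $\hat{\mathcal{U}}=\mathrm{diag}(\hat U_1,\dots,\hat U_n)$ (block diagonal) with \[ U_j=\begin{bmatrix} I_k\otimes h_j^{3/2}\bar\Gamma\bar V & 0\\ 0& I_{m-k}\otimes h_j^{1/2}\Gamma V\end{bmatrix},\qquad \hat U_j=\begin{bmatrix} I_k\otimes\begin{bmatrix}h_j^{3/2}\bar\Gamma\bar V\\ h_j^{1/2}\bar\Gamma\mathring V\end{bmatrix}&0\\ 0& I_{m-k}\otimes h_j^{1/2}\Gamma V\end{bmatrix}. \] The singular values of $\mathcal{U}$, $\hat{\mathcal{U}}$ are the square roots of the eigenvalues of $\mathcal{U}^T\mathcal{U}$, $\hat{\mathcal{U}}^T\hat{\mathcal{U}}$. *)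

(* Defs.v *)
From HB Require Import structures.
From mathcomp Require Import all_boot all_order all_algebra.
From mathcomp Require Import qpoly mxtens.
From mathcomp Require Import all_classical all_reals all_analysis.

Set Implicit Arguments.
Unset Strict Implicit.
Unset Printing Implicit Defensive.

Import Order.TTheory GRing.Theory Num.Theory.
Import numFieldNormedType.Exports.

Local Open Scope classical_set_scope.
Local Open Scope ring_scope.

(* Conventions. The n subintervals are numbered from 0: the j-th one is
   [t j, t j.+1] for j : 'I_n. The m components are numbered by
   'I_k + 'I_(m - k): [inl] for the first k (differentiable) ones, [inr] for the
   remaining m - k (algebraic) ones; k < m is always assumed. *)

Definition step (R : realType) (t : nat -> R) (j : nat) : R := t j.+1 - t j.

(* A piecewise polynomial function is identified with the family of its pieces:
   x j kappa is the polynomial (in the global variable) with which the component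
   kappa coincides on the j-th subinterval. *)
Definition pieces (R : realType) (n k m : nat) : Type :=
  'I_n -> 'I_k + 'I_(m - k) -> {poly R}.

(* Recall that size f = deg f + 1, and size 0 = 0. *)
Definition Xpi (R : realType) (n k m N : nat) : set (@pieces R n k m) :=
  [set x | forall j : 'I_n,
     (forall kappa : 'I_k, (size (x j (inl kappa)) <= N.+1)%N) /\
     (forall kappa : 'I_(m - k), (size (x j (inr kappa)) <= N)%N)].

Definition integral_basis (R : realType) (N : nat)
    (p : 'I_N -> {poly R}) (pbar : 'I_N.+1 -> {poly R}) : Prop :=
  pbar ord0 = 1 /\
  forall (i : 'I_N) (tau : R), 0 <= tau <= 1 ->
    (pbar (lift ord0 i)).[tau] =
      \int[lebesgue_measure]_(s in `[0, tau]) (p i).[s].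

(* The polynomial t |-> f ((t - t_(j-1)) / h_j). *)
Definition rescale (R : realType) (t : nat -> R) (j : nat) (f : {poly R}) :
    {poly R} := f \Po ((step t j)^-1 *: ('X - (t j)%:P)).

Definition blocksize (k m N : nat) : nat := (k * N.+1 + (m - k) * N)%N.

(* The coefficient space R^(n (m N + k)), see [coefdimE]; the dimension is written
   so as to expose the blocks c_(j kappa). *)
Definition coefdim (n k m N : nat) : nat := (\sum_(j < n) blocksize k m N)%N.

Lemma coefdimE (n k m N : nat) :
  (k < m)%N -> coefdim n k m N = (n * (m * N + k))%N.
Proof.
move=> /ltnW km; rewrite /coefdim sum_nat_const card_ord /blocksize.
by rewrite [(k * _)%N]mulnS -addnA -mulnDl subnKC // addnC.
Qed.

Section Coefficients.
Context {R : realType} {n k m N : nat}.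
Implicit Types (c : 'cV[R]_(coefdim n k m N)) (j : 'I_n).

Definition coefblock c j : 'cV[R]_(k * N.+1 + (m - k) * N) :=
  @submxcol R n (fun _ : 'I_n => blocksize k m N) 1 c j.

Definition coefd c j (kappa : 'I_k) (l : 'I_N.+1) : R :=
  usubmx (coefblock c j) (mxtens_index (kappa, l)) 0.

Definition coefa c j (kappa : 'I_(m - k)) (l : 'I_N) : R :=
  dsubmx (coefblock c j) (mxtens_index (kappa, l)) 0.

Definition reprmap (t : nat -> R) (p : 'I_N -> {poly R})
    (pbar : 'I_N.+1 -> {poly R}) c : pieces R n k m :=
  fun j kappa => match kappa with
  | inl kappa => \sum_(l < N.+1)
      coefd c j kappa l *: (step t j *: rescale t j (pbar l))
  | inr kappa => \sum_(l < N) coefa c j kappa l *: rescale t j (p l)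
  end.

(* [pinv] is the inverse, on [Xpi], of the bijection [reprmap] from the whole
   coefficient space. *)
Definition reprmapV (t : nat -> R) (p : 'I_N -> {poly R})
    (pbar : 'I_N.+1 -> {poly R}) : pieces R n k m -> 'cV[R]_(coefdim n k m N) :=
  'pinv_(fun=> 0) setT (reprmap t p pbar).

End Coefficients.

Definition enorm (R : realType) (d : nat) (c : 'cV[R]_d) : R :=
  Num.sqrt (\sum_(i < d) c i 0 ^+ 2).

Definition sqint (R : realType) (t : nat -> R) (j : nat) (f : {poly R}) : R :=
  \int[lebesgue_measure]_(s in `[t j, t j.+1]) `|f.[s]| ^+ 2.

Definition L2norm (R : realType) (n k m : nat) (t : nat -> R)
    (x : pieces R n k m) : R :=
  Num.sqrt (\sum_(j < n) \sum_kappa sqint t j (x j kappa)).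

Definition H1norm (R : realType) (n k m : nat) (t : nat -> R)
    (x : pieces R n k m) : R :=
  Num.sqrt (\sum_(j < n)
    (\sum_(kappa < k)
       \int[lebesgue_measure]_(s in `[t j, t j.+1])
          (`|(x j (inl kappa)).[s]| ^+ 2 + `|(x j (inl kappa))^`().[s]| ^+ 2) +
     \sum_(kappa < m - k) sqint t j (x j (inr kappa)))).

Definition opnorm (R : realType) (V W : Type) (D : set V)
    (normV : V -> R) (normW : W -> R) (f : V -> W) : R :=
  sup [set normW (f v) | v in [set v | D v /\ normV v <= 1]].

(* Exactness, for polynomials of degree at most d, of the quadrature formula on
   [0, 1] with nodes x and weights w. *)
Definition quadrature_exact (R : realType) (d q : nat) (x w : 'I_q -> R) : Prop :=
  forall f : {poly R}, (size f <= d.+1)%N ->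
    \int[lebesgue_measure]_(s in `[0, 1]) f.[s] = \sum_(i < q) w i * f.[x i].

Definition evalmx (R : realType) (q d : nat) (x : 'I_q -> R)
    (f : 'I_d -> {poly R}) : 'M[R]_(q, d) := \matrix_(i, l) (f l).[x i].

Definition sqrtdiag (R : realType) (q : nat) (w : 'I_q -> R) : 'M[R]_q :=
  diag_mx (\row_i Num.sqrt (w i)).

Section Matrices.
Context {R : realType} {n k m N : nat}.
Variables (t : nat -> R) (p : 'I_N -> {poly R}) (pbar : 'I_N.+1 -> {poly R}).
Variables (sbar gbar : 'I_N.+1 -> R) (s g : 'I_N -> R).

Let GVbar : 'M[R]_N.+1 := sqrtdiag gbar *m evalmx sbar pbar.
Let GVring : 'M[R]_N.+1 :=
  sqrtdiag gbar *m evalmx sbar (fun l => (pbar l)^`()).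
Let GV : 'M[R]_N := sqrtdiag g *m evalmx s p.

Definition Ublock (j : 'I_n) : 'M[R]_(k * N.+1 + (m - k) * N) :=
  let h := step t j in
  block_mx (1%:M *t (h `^ (3 / 2) *: GVbar)) 0
           0 (1%:M *t (h `^ (1 / 2) *: GV)).

Definition Uhatblock (j : 'I_n) :
    'M[R]_(k * (N.+1 + N.+1) + (m - k) * N, k * N.+1 + (m - k) * N) :=
  let h := step t j in
  block_mx (1%:M *t col_mx (h `^ (3 / 2) *: GVbar) (h `^ (1 / 2) *: GVring)) 0
           0 (1%:M *t (h `^ (1 / 2) *: GV)).

Definition Umx : 'M[R]_(coefdim n k m N) := \mxdiag_(j < n) Ublock j.

(* The blocks are rectangular here, so [mxdiag] does not apply. *)
Definition Uhatmx :
    'M[R]_(\sum_(j < n) (k * (N.+1 + N.+1) + (m - k) * N), coefdim n k m N) :=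
  \mxblock_(i < n, j < n) (if i == j then Uhatblock j else 0).

End Matrices.

Definition singular_values (R : realType) (q d : nat) (A : 'M[R]_(q, d)) : set R :=
  [set Num.sqrt a | a in [set a | eigenvalue (A^T *m A) a]].

(* The set of singular values is finite, so that [sup] and [inf] are its maximum
   and its minimum. *)
Definition sigma_max (R : realType) (q d : nat) (A : 'M[R]_(q, d)) : R :=
  sup (singular_values A).

Definition sigma_min (R : realType) (q d : nat) (A : 'M[R]_(q, d)) : R :=
  inf (singular_values A).

(* Main.v *)
(** Rescaling to [0, 1] and the exactness of the quadrature formulae for the
    squares of the polynomial pieces (and of their derivatives) turn the function
    norms into Euclidean ones: [L2norm (R c) = |U c|] and [H1norm (R c) = |Uhat c|].
    Hence the norms of R and of its inverse are the extreme values of [|U c|], resp.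
    [|Uhat c|], on the unit sphere, that is, square roots of extreme values of the
    Rayleigh quotient of [U^T U], which are eigenvalues. *)
Require Import Defs.
From HB Require Import structures.
From mathcomp Require Import all_boot all_order all_algebra.
From mathcomp Require Import qpoly mxtens.
From mathcomp Require Import all_classical all_reals all_analysis.
From mathcomp Require Import ring lra zify.

Set Implicit Arguments.
Unset Strict Implicit.
Unset Printing Implicit Defensive.

Import Order.TTheory GRing.Theory Num.Theory.
Import numFieldNormedType.Exports.

Local Open Scope classical_set_scope.
Local Open Scope ring_scope.

(** Extreme eigenvalues are obtained from order completeness of the reals, without compactness of
    the sphere or a spectral theorem: the best lower bound of the quadratic form is a supremum, and
    the maximal case is the minimal one for the negated matrix. The exponents in the blocks have two
    sources. The substitution to [0, 1] contributes h to each squared norm, and the factor h in the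
    functions pbar_ji contributes h^2, whence h^(3/2) on values; differentiation takes h^2 away
    again, whence h^(1/2) on derivatives. The degrees of exactness 2N and 2N - 2 are the degrees of
    the squares of the two kinds of pieces. The formula for the inverse also requires sigma_min to
    be positive, that is, injective matrices; this holds because there are as many nodes as basis
    polynomials. *)

(** * Extreme Rayleigh quotients of a real symmetric matrix *)

Section QuadraticForms.
Variables (R : realType) (d : nat).
Implicit Types (S : 'M[R]_d) (x y : 'cV[R]_d).

Definition bform S x y : R := (x^T *m S *m y) 0 0.

Lemma bformC S x y : S^T = S -> bform S x y = bform S y x.
Proof.
move=> symS; rewrite /bform -[in LHS]mulmxA -[x^T *m (S *m y)]trmxK mxE.
by rewrite !trmx_mul trmxK symS.
Qed.

Lemma bformDl S x x' y : bform S (x + x') y = bform S x y + bform S x' y.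
Proof. by rewrite /bform linearD /= !mulmxDl mxE. Qed.

Lemma bformDr S x y y' : bform S x (y + y') = bform S x y + bform S x y'.
Proof. by rewrite /bform mulmxDr mxE. Qed.

Lemma bformZl S a x y : bform S (a *: x) y = a * bform S x y.
Proof. by rewrite /bform linearZ /= -!scalemxAl mxE. Qed.

Lemma bformZr S a x y : bform S x (a *: y) = a * bform S x y.
Proof. by rewrite /bform -scalemxAr mxE. Qed.

Lemma bformB S S' x y : bform (S - S') x y = bform S x y - bform S' x y.
Proof. by rewrite /bform mulmxBr mulmxBl !mxE. Qed.

Lemma bform_scalar a x y : bform a%:M x y = a * bform 1%:M x y.
Proof. by rewrite /bform mul_mx_scalar mulmx1 -scalemxAl mxE. Qed.

Lemma bform_eigen S a x y : S *m y = a *: y -> bform S x y = a * bform 1%:M x y.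
Proof. by move=> Sy; rewrite /bform -mulmxA Sy -scalemxAr mxE mulmx1. Qed.

Lemma enorm_ge0 x : 0 <= enorm x. Proof. exact: sqrtr_ge0. Qed.

Lemma enorm_sqrE x : enorm x ^+ 2 = \sum_i x i 0 ^+ 2.
Proof. by rewrite sqr_sqrtr //; apply: sumr_ge0 => i _; exact: sqr_ge0. Qed.

Lemma enorm_sqr x : enorm x ^+ 2 = bform 1%:M x x.
Proof.
rewrite enorm_sqrE /bform mulmx1 mxE.
by apply: eq_bigr => i _; rewrite mxE expr2.
Qed.

Lemma enormZ a x : enorm (a *: x) = `|a| * enorm x.
Proof.
apply: (pexpIrn (n := 2)); rewrite ?nnegrE ?mulr_ge0 ?enorm_ge0 //.
by rewrite exprMn !enorm_sqr bformZl bformZr mulrA -expr2 real_normK ?num_real.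
Qed.

Lemma enorm0 : enorm (0 : 'cV[R]_d) = 0.
Proof. by rewrite -(scale0r (0 : 'cV[R]_d)) enormZ normr0 mul0r. Qed.

Lemma enorm_eq0 x : (enorm x == 0) = (x == 0).
Proof.
apply/idP/eqP => [|->]; last by rewrite enorm0.
have -> : (enorm x == 0) = (enorm x ^+ 2 == 0) by rewrite sqrf_eq0.
rewrite enorm_sqrE psumr_eq0; last by move=> *; exact: sqr_ge0.
move=> /allP x0; apply/matrixP => i j; rewrite ord1 mxE; apply/eqP.
by have := x0 i (mem_index_enum _); rewrite /= sqrf_eq0.
Qed.

Lemma ler_norm_enorm x i : `|x i 0| <= enorm x.
Proof.
rewrite -(@ler_pXn2r _ 2) ?nnegrE ?enorm_ge0 //.
rewrite real_normK ?num_real // enorm_sqrE (bigD1 i) //= lerDl.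
by apply: sumr_ge0 => j _; exact: sqr_ge0.
Qed.

(** A crude constant is enough: for S it provides one admissible lower bound of the form, and for
    the inverse of S it yields coercivity. *)
Lemma bform_bounded S :
  exists2 K : R, 0 <= K & forall x, `|bform S x x| <= K * enorm x ^+ 2.
Proof.
exists (\sum_j \sum_i `|S i j|); first by do 2!apply: sumr_ge0 => ? _.
move=> x; rewrite /bform mxE (le_trans (ler_norm_sum _ _ _)) //.
rewrite mulr_suml; apply: ler_sum => j _; rewrite mxE normrM.
rewrite expr2 mulrA ler_pM ?ler_norm_enorm //.
rewrite (le_trans (ler_norm_sum _ _ _)) // mulr_suml.
apply: ler_sum => i _; rewrite mxE normrM mulrC.
by rewrite ler_wpM2l ?ler_norm_enorm.
Qed.

Lemma psd_cauchy_schwarz S x y : S^T = S -> (forall z, 0 <= bform S z z) ->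
  bform S x y ^+ 2 <= bform S x x * bform S y y.
Proof.
move=> symS psdS.
have expand u v (a b : R) : bform S (a *: u + b *: v) (a *: u + b *: v) =
    a ^+ 2 * bform S u u + (a * b * bform S u v) *+ 2 + b ^+ 2 * bform S v v.
  rewrite !(bformDl, bformDr, bformZl, bformZr) (bformC v u symS).
  by ring.
(* S is only semidefinite, so both diagonal values may vanish. With the larger one on y, a zero
   there forces both to be zero, and then the form at x - (bform S x y) y is -2 (bform S x y)^2. *)
wlog : x y / bform S x x <= bform S y y => [wl|xy].
  have [/wl//|/ltW/wl] := leP (bform S x x) (bform S y y).
  by rewrite (bformC y x symS) [X in _ <= X]mulrC.
have [y0|] := eqVneq (bform S y y) 0.
  have x0 : bform S x x = 0 by apply/le_anti; rewrite psdS -y0 xy.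
  have := psdS (1 *: x + (- bform S x y) *: y).
  rewrite expand x0 y0; nra.
move=> yN0; have yp : 0 < bform S y y by rewrite lt_neqAle eq_sym yN0 psdS.
rewrite -(ler_pM2l yp).
(* A multiple of the part of x that is S-orthogonal to y, scaled to avoid division; its form is
   bform S y y times the difference of the two sides. *)
have := psdS (bform S y y *: x + (- bform S x y) *: y).
by rewrite expand; nra.
Qed.

(* For invertible [S], Cauchy-Schwarz applied to [x] and [S^-1 x] yields
   [|x|^4 <= bform S x x * bform S^-1 x x]. *)
Lemma psd_unit_coercive S : S^T = S -> (forall z, 0 <= bform S z z) ->
  S \in unitmx ->
  exists2 e : R, 0 < e & forall x, e * enorm x ^+ 2 <= bform S x x.
Proof.
move=> symS psdS uS; have [K K0 KP] := bform_bounded (invmx S).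
(* The bound K is only known to be nonnegative; adding 1 makes it invertible. *)
exists (K + 1)^-1; first by rewrite invr_gt0 ltr_wpDl.
move=> x; rewrite ler_pdivrMl ?ltr_wpDl //.
have [->|xN0] := eqVneq x 0.
  by rewrite /bform mulmx0 mxE mulr0 enorm0 expr0n.
have x0 : 0 < enorm x ^+ 2.
  by rewrite exprn_gt0 // lt_neqAle enorm_ge0 eq_sym enorm_eq0 xN0.
rewrite -(ler_pM2r x0).
have := psd_cauchy_schwarz x (invmx S *m x) symS psdS.
have -> : bform S x (invmx S *m x) = enorm x ^+ 2.
  by rewrite enorm_sqr /bform mulmx1 mulmxA mulmxK.
have -> : bform S (invmx S *m x) (invmx S *m x) = bform (invmx S) x x.
  rewrite /bform trmx_mul -!mulmxA [S *m _]mulmxA mulmxV // mul1mx.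
  by rewrite trmx_inv symS.
move=> CS; rewrite -expr2 (le_trans CS) // mulrAC [leRHS]mulrC ler_wpM2l //.
by rewrite (le_trans (ler_norm _)) // (le_trans (KP x)) // ler_wpM2r ?lerDl ?ltW.
Qed.

Lemma exists_unit_vector : (0 < d)%N -> exists x : 'cV[R]_d, enorm x = 1.
Proof.
move=> d0; exists (delta_mx (Ordinal d0) 0).
apply: (pexpIrn (n := 2)); rewrite ?nnegrE ?enorm_ge0 // expr1n.
rewrite enorm_sqrE (bigD1 (Ordinal d0)) //= mxE !eqxx expr1n big1 ?addr0 // => i.
by move=> /negPf ni; rewrite mxE ni expr0n.
Qed.

Lemma normalize_vector x : x != 0 -> enorm ((enorm x)^-1 *: x) = 1.
Proof.
move=> x0; rewrite enormZ ger0_norm ?invr_ge0 ?enorm_ge0 // mulVf //.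
by rewrite enorm_eq0.
Qed.

(* The eigenvalue is the largest [l] with [S - l] positive semidefinite: by
   maximality [S - l] is not coercive, hence singular. *)
Lemma min_eigenvector S : (0 < d)%N -> S^T = S ->
  exists l x, [/\ enorm x = 1, S *m x = l *: x &
    forall y, l * enorm y ^+ 2 <= bform S y y].
Proof.
move=> d0 symS.
pose L : set R := [set l | forall y, l * enorm y ^+ 2 <= bform S y y].
have [K K0 KP] := bform_bounded S.
have LN0 : L !=set0.
  by exists (- K) => y; rewrite mulNr lerNl (le_trans _ (KP y)) // -normrN ler_norm.
have [e e1] := exists_unit_vector d0.
have ubL : has_ubound L.
  by exists (bform S e e) => l /(_ e); rewrite e1 expr1n mulr1.
(* For a fixed nonzero y, membership in L bounds l above by the Rayleigh quotient at y, and such a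
   bound passes to the supremum. *)
have supL : L (sup L).
  move=> y; have [->|yN0] := eqVneq y 0.
    rewrite enorm0 expr0n mulr0.
    by rewrite /bform mulmx0 mxE.
  have y0 : 0 < enorm y ^+ 2.
    by rewrite exprn_gt0 // lt_neqAle enorm_ge0 eq_sym enorm_eq0 yN0.
  rewrite -ler_pdivlMr //; apply: ge_sup => // l /(_ y).
  by rewrite ler_pdivlMr.
pose B := S - (sup L)%:M.
have symB : B^T = B by rewrite /B linearB /= symS tr_scalar_mx.
have BE z : bform B z z = bform S z z - sup L * enorm z ^+ 2.
  by rewrite bformB bform_scalar enorm_sqr.
have psdB z : 0 <= bform B z z by rewrite BE subr_ge0.
have [uB|] := boolP (B \in unitmx).
  have [r r0 rP] := psd_unit_coercive symB psdB uB.
  suff /(ub_le_sup ubL) : L (sup L + r) by lra.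
  by move=> y; rewrite mulrDl -lerBrDl -BE.
(* [det0P] yields a row vector in the left kernel; the symmetry of B turns its transpose into an
   eigenvector of S. *)
rewrite unitmxE unitfE negbK => /det0P [v vN0 vB].
have vTN0 : v^T != 0 by rewrite trmx_eq0.
exists (sup L), ((enorm v^T)^-1 *: v^T); split => //.
  exact: normalize_vector.
rewrite -scalemxAr scalerA mulrC -scalerA; congr (_ *: _).
apply/eqP; rewrite -subr_eq0 -mul_scalar_mx -mulmxBl -/B -symB -trmx_mul vB.
by rewrite linear0.
Qed.

Lemma max_eigenvector S : (0 < d)%N -> S^T = S ->
  exists l x, [/\ enorm x = 1, S *m x = l *: x &
    forall y, bform S y y <= l * enorm y ^+ 2].
Proof.
move=> d0 symS; have symNS : (- S)^T = - S by rewrite linearN /= symS.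
have [l [x [x1 Sx lP]]] := min_eigenvector d0 symNS.
exists (- l), x; split => //.
  by rewrite scaleNr -Sx mulNmx opprK.
move=> y; rewrite mulNr -lerN2 opprK (le_trans (lP y)) //.
by rewrite /bform mulmxN mulNmx mxE.
Qed.

End QuadraticForms.

(** * Singular values as extremes of |A x| on the unit sphere, and the operator norms they
    determine *)

Section SingularValues.
Variables (R : realType) (q d : nat) (A : 'M[R]_(q, d)).

Lemma bform_gram x : bform (A^T *m A) x x = enorm (A *m x) ^+ 2.
Proof. by rewrite enorm_sqr /bform mulmx1 trmx_mul !mulmxA. Qed.

Lemma gram_sym : (A^T *m A)^T = A^T *m A.
Proof. by rewrite trmx_mul trmxK. Qed.

(** The eigenvalue l equals |A x|^2 because x is a unit vector. Since [eigenvalue] refers to row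
    eigenvectors, x is transposed, which the symmetry of the Gram matrix permits. *)
Lemma eigenvector_singular_value l x : enorm x = 1 -> A^T *m A *m x = l *: x ->
  singular_values A (enorm (A *m x)).
Proof.
move=> x1 Ax; have lE : enorm (A *m x) ^+ 2 = l.
  by rewrite -bform_gram (bform_eigen _ Ax) -enorm_sqr x1 expr1n mulr1.
exists l => /=; last by rewrite -lE sqrtr_sqr ger0_norm ?enorm_ge0.
apply/eigenvalueP; exists x^T.
  by rewrite -gram_sym -trmx_mul Ax linearZ.
apply: contra_eq_neq x1 => /(congr1 trmx); rewrite trmxK linear0 => ->.
by rewrite enorm0 eq_sym oner_neq0.
Qed.

Lemma singular_valueP r : singular_values A r ->
  exists2 x, enorm x = 1 & enorm (A *m x) = r.
Proof.
move=> [a /eigenvalueP [v vA vN0] <-].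
have vTN0 : v^T != 0 by rewrite trmx_eq0.
exists ((enorm v^T)^-1 *: v^T); first exact: normalize_vector.
set x := _ *: _; have x1 : enorm x = 1 by exact: normalize_vector.
have Ax : A^T *m A *m x = a *: x.
  rewrite /x -scalemxAr scalerA mulrC -scalerA; congr (_ *: _).
  by rewrite -gram_sym -trmx_mul vA linearZ.
rewrite -[LHS]ger0_norm ?enorm_ge0 // -sqrtr_sqr -bform_gram (bform_eigen _ Ax).
by rewrite -enorm_sqr x1 expr1n mulr1.
Qed.

Hypothesis d_gt0 : (0 < d)%N.

(** For the top unit eigenvector x of the Gram matrix, |A x| is a singular value and bounds all the
    others, so the supremum is attained there. *)
Lemma sigma_maxP : exists x, [/\ enorm x = 1, enorm (A *m x) = sigma_max A &
  forall y, enorm (A *m y) <= sigma_max A * enorm y].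
Proof.
have [l [x [x1 Ax lP]]] := max_eigenvector d_gt0 gram_sym.
have lE : enorm (A *m x) ^+ 2 = l.
  by rewrite -bform_gram (bform_eigen _ Ax) -enorm_sqr x1 expr1n mulr1.
have xP y : enorm (A *m y) <= enorm (A *m x) * enorm y.
  rewrite -(@ler_pXn2r _ 2) ?nnegrE ?mulr_ge0 ?enorm_ge0 //.
  by rewrite exprMn lE -bform_gram.
suff <- : enorm (A *m x) = sigma_max A by exists x.
have svx := eigenvector_singular_value x1 Ax.
have ub : ubound (singular_values A) (enorm (A *m x)).
  by move=> r /singular_valueP [y y1 <-]; rewrite (le_trans (xP y)) // y1 mulr1.
apply/le_anti/andP; split; first by apply: ub_le_sup => //; exists (enorm (A *m x)).
by apply: ge_sup => //; exists (enorm (A *m x)).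
Qed.

Lemma sigma_minP : exists x, [/\ enorm x = 1, enorm (A *m x) = sigma_min A &
  forall y, sigma_min A * enorm y <= enorm (A *m y)].
Proof.
have [l [x [x1 Ax lP]]] := min_eigenvector d_gt0 gram_sym.
have lE : enorm (A *m x) ^+ 2 = l.
  by rewrite -bform_gram (bform_eigen _ Ax) -enorm_sqr x1 expr1n mulr1.
have xP y : enorm (A *m x) * enorm y <= enorm (A *m y).
  rewrite -(@ler_pXn2r _ 2) ?nnegrE ?mulr_ge0 ?enorm_ge0 //.
  by rewrite exprMn lE -bform_gram.
suff <- : enorm (A *m x) = sigma_min A by exists x.
have svx := eigenvector_singular_value x1 Ax.
have lb : lbound (singular_values A) (enorm (A *m x)).
  by move=> r /singular_valueP [y y1 <-]; rewrite (le_trans _ (xP y)) // y1 mulr1.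
apply/le_anti/andP; split; last by apply: ge_inf => //; exists (enorm (A *m x)).
by apply: lb_le_inf => //; exists (enorm (A *m x)).
Qed.

Variables (W : Type) (normW : W -> R) (f : 'cV[R]_d -> W).
Hypothesis normW_f : forall c, normW (f c) = enorm (A *m c).

(** Only the identity [normW_f] is known about W, so the L^2 and H^1 cases are two instances of one
    argument. *)
Lemma opnorm_sigma_max : opnorm setT (@enorm R d) normW f = sigma_max A.
Proof.
have [x [x1 xmax xP]] := sigma_maxP.
have sv : [set normW (f v) | v in [set v | setT v /\ enorm v <= 1]] (sigma_max A).
  by exists x; rewrite ?normW_f //= x1.
have ub : ubound [set normW (f v) | v in [set v | setT v /\ enorm v <= 1]]
    (sigma_max A).
  move=> _ [c /= [_ c1] <-]; rewrite normW_f (le_trans (xP c)) //.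
  by rewrite ler_piMr // -xmax enorm_ge0.
apply/le_anti/andP; split; first by apply: ge_sup => //; exists (sigma_max A).
by apply: ub_le_sup => //; exists (sigma_max A).
Qed.

(** Writing w = f c turns the problem into maximizing |c| subject to |A c| <= 1. Injectivity of A
    makes [sigma_min A] positive, and the maximum is attained at the minimizing unit vector divided
    by [sigma_min A]. *)
Lemma opnorm_sigma_min (D : set W) (g : W -> 'cV[R]_d) :
  D = range f -> cancel f g -> (forall c : 'cV[R]_d, A *m c = 0 -> c = 0) ->
  opnorm D normW (@enorm R d) g = (sigma_min A)^-1.
Proof.
move=> -> fK Ainj; have [x [x1 xmin xP]] := sigma_minP.
have sA : 0 < sigma_min A.
  rewrite -xmin lt_neqAle enorm_ge0 eq_sym enorm_eq0 andbT.
  apply: contra_eq_neq x1 => /Ainj ->.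
  by rewrite enorm0 eq_sym oner_neq0.
rewrite /opnorm; set E := [set _ | _ in _].
have sv : E (sigma_min A)^-1.
  exists (f ((sigma_min A)^-1 *: x)); last first.
    by rewrite fK enormZ x1 mulr1 ger0_norm // invr_ge0 ltW.
  split; first by exists ((sigma_min A)^-1 *: x).
  rewrite normW_f -scalemxAr enormZ xmin ger0_norm ?invr_ge0 ?(ltW sA) //.
  by rewrite mulVf // gt_eqF.
have ub : ubound E (sigma_min A)^-1.
  move=> r [w /= [[c _ <-]]]; rewrite normW_f => c1 <-; rewrite fK.
  by rewrite -[leRHS]mul1r ler_pdivlMr // mulrC (le_trans (xP c)).
apply/le_anti/andP; split; first by apply: ge_sup => //; exists (sigma_min A)^-1.
by apply: ub_le_sup => //; exists (sigma_min A)^-1.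
Qed.

End SingularValues.

(** * Integrals, zeros and affine substitution of polynomials *)

Section PolynomialIntegrals.
Variable R : realType.
Implicit Types (f F : {poly R}) (a b : R).

(** Through a polynomial primitive, linearity and substitution for integrals become polynomial
    algebra, free of integrability conditions. *)
Lemma poly_primitive f : exists2 F, F^`() = f & (size F <= (size f).+1)%N.
Proof.
exists (\poly_(i < (size f).+1) (f`_i.-1 / i%:R)); last exact: size_poly.
apply/polyP => i; rewrite coef_deriv coef_poly ltnS.
case: ltnP => [_|sf]; last by rewrite mul0rn nth_default.
by rewrite /= -[LHS]mulr_natr mulfVK // pnatr_eq0.
Qed.

Lemma Rintegral_deriv F a b : a <= b ->
  \int[lebesgue_measure]_(s in `[a, b]) (F^`()).[s] = F.[b] - F.[a].
Proof.
rewrite le_eqVlt => /predU1P [->|ab].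
  by rewrite set_itv1 Rintegral_set1 subrr.
rewrite /Rintegral (@continuous_FTC2 _ (horner F^`()) (horner F)) //=.
- by apply: continuous_subspaceT => x; exact: continuous_horner.
- split=> [x _||].
  + exact: derivable_horner.
  + by apply: cvg_at_right_filter; exact: continuous_horner.
  + by apply: cvg_at_left_filter; exact: continuous_horner.
- by move=> x _; rewrite derivE.
Qed.

Lemma poly_eq_on01 f F : (forall x : R, 0 <= x <= 1 -> f.[x] = F.[x]) -> f = F.
Proof.
move=> fF; apply/eqP; rewrite -subr_eq0.
(* The points 1, 1/2, 1/3, ... are distinct and lie in [0, 1]; taking [size (f - F)] of them exceeds
   the possible number of roots of a nonzero difference. *)
pose r := [seq i.+1%:R^-1 : R | i <- iota 0 (size (f - F))].
apply/eqP/(@roots_geq_poly_eq0 _ _ r); last by rewrite size_map size_iota.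
- apply/allP => x /mapP [i _ ->]; rewrite rootE !hornerE fF ?subrr //.
  by rewrite invr_ge0 ler0n /= invf_le1 ?ltr0n // ler1n.
- rewrite map_inj_uniq ?iota_uniq // => i j /invr_inj /eqP.
  by rewrite eqr_nat => /eqP [].
Qed.

Lemma poly_eq0_nodes (q : nat) (x : 'I_q -> R) f :
  {homo x : i j / (i < j)%N >-> i < j} -> (size f <= q)%N ->
  (forall i, f.[x i] = 0) -> f = 0.
Proof.
move=> xmono fq fx; apply: (@roots_geq_poly_eq0 _ _ (codom x)).
- by apply/allP => y /codomP [i ->]; rewrite rootE fx.
- rewrite map_inj_uniq ?enum_uniq // => i j xij; apply: val_inj.
  by have [/xmono|/xmono|] := ltngtP i j; rewrite ?xij ?ltxx.
- by rewrite size_codom card_ord.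
Qed.

Section Rescale.
Variables (t : nat -> R) (j : nat).
Hypothesis tj : t j < t j.+1.

Let h0 : 0 < step t j. Proof. by rewrite subr_gt0. Qed.
Let hN0 : step t j != 0. Proof. by rewrite gt_eqF. Qed.

Lemma deriv_rescale f : (rescale t j f)^`() = (step t j)^-1 *: rescale t j f^`().
Proof.
by rewrite /rescale deriv_comp derivZ derivXsubC alg_polyC mulrC mul_polyC.
Qed.

Lemma horner_rescale f x : (rescale t j f).[x] = f.[(step t j)^-1 * (x - t j)].
Proof. by rewrite /rescale horner_comp !hornerE. Qed.

Lemma Rintegral_rescale f :
  \int[lebesgue_measure]_(s in `[t j, t j.+1]) (rescale t j f).[s] =
  step t j * \int[lebesgue_measure]_(s in `[0, 1]) f.[s].
Proof.
have [F <- _] := poly_primitive f.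
rewrite Rintegral_deriv ?ler01 //.
have -> : rescale t j F^`() = (step t j *: rescale t j F)^`().
  by rewrite derivZ deriv_rescale scalerA mulfV // scale1r.
rewrite Rintegral_deriv 1?ltW // !hornerE !horner_rescale subrr mulr0.
by rewrite -/(step t j) mulVf // mulrBr.
Qed.

Definition unscale f : {poly R} := f \Po (step t j *: 'X + (t j)%:P).

Lemma unscaleK : cancel unscale (rescale t j).
Proof.
move=> f; rewrite /rescale /unscale -comp_polyA.
rewrite comp_polyD comp_polyZ comp_polyX comp_polyC scalerA mulfV // scale1r.
by rewrite subrK comp_polyXr.
Qed.

Lemma rescaleK : cancel (rescale t j) unscale.
Proof.
move=> f; rewrite /rescale /unscale -comp_polyA.
rewrite comp_polyZ comp_polyB comp_polyX comp_polyC addrK scalerA mulVf //.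
by rewrite scale1r comp_polyXr.
Qed.

Lemma size_rescale f : size (rescale t j f) = size f.
Proof.
rewrite /rescale size_comp_poly2 // size_scale ?invr_eq0 //.
exact: size_XsubC.
Qed.

Lemma size_unscale f : size (unscale f) = size f.
Proof. by rewrite -[in RHS](unscaleK f) size_rescale. Qed.

End Rescale.
End PolynomialIntegrals.

(** * Polynomial bases, their integrals, and quadrature as a Euclidean norm *)

Section PolynomialBases.
Variable R : realType.

Lemma Rintegral_polyD (f g : {poly R}) a b : a <= b ->
  \int[lebesgue_measure]_(s in `[a, b]) (f + g).[s] =
  \int[lebesgue_measure]_(s in `[a, b]) f.[s] +
  \int[lebesgue_measure]_(s in `[a, b]) g.[s].
Proof.
move=> ab; have [F <- _] := poly_primitive f; have [G <- _] := poly_primitive g.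
by rewrite -derivD !Rintegral_deriv // !hornerD; ring.
Qed.

Lemma Rintegral_polyZ c (f : {poly R}) a b : a <= b ->
  \int[lebesgue_measure]_(s in `[a, b]) (c *: f).[s] =
  c * \int[lebesgue_measure]_(s in `[a, b]) f.[s].
Proof.
move=> ab; have [F <- _] := poly_primitive f.
by rewrite -derivZ !Rintegral_deriv // !hornerZ mulrBr.
Qed.

Definition lincomb (q : nat) (e : 'I_q -> {poly R}) (u : 'cV[R]_q) : {poly R} :=
  \sum_l u l 0 *: e l.

(** Stated for plain polynomials so that it covers both p, given in [{poly_N R}], and pbar, which is
    not given in a space of bounded degree. *)
Definition poly_basis (q : nat) (e : 'I_q -> {poly R}) : Prop :=
  [/\ forall l, (size (e l) <= q)%N,
      forall f : {poly R}, (size f <= q)%N -> exists u, f = lincomb e u &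
      forall u, lincomb e u = 0 -> u = 0].

Lemma size_lincomb (q r : nat) (e : 'I_q -> {poly R}) u :
  (forall l, (size (e l) <= r)%N) -> (size (lincomb e u) <= r)%N.
Proof.
move=> er; apply: (leq_trans (size_sum _ _ _)); apply/bigmax_leqP => l _.
exact: leq_trans (size_scale_leq _ _) (er l).
Qed.

Lemma deriv_lincomb (q : nat) (e : 'I_q -> {poly R}) u :
  (lincomb e u)^`() = lincomb (fun l => (e l)^`()) u.
Proof. by rewrite raddf_sum; apply: eq_bigr => l _; rewrite /= derivZ. Qed.

Lemma poly_basis_npoly (N : nat) (p : N.-tuple {poly_N R}) :
  basis_of {:{poly_N R}} p -> poly_basis (fun i => polyn (tnth p i)).
Proof.
move=> pb; have lincombE u :
    lincomb (fun i => polyn (tnth p i)) u = \sum_i u i 0 *: p`_i :> {poly R}.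
  rewrite /lincomb (big_morph (@polyn R N) (id1 := 0) (op1 := +%R)) //.
  apply: eq_bigr => i _.
  by rewrite (tnth_nth 0).
split=> [l|f sf|u]; first exact: size_npoly.
- exists (\col_i coord p i (npolyp N f)); rewrite lincombE -[LHS](npolypK sf).
  rewrite [in LHS](coord_basis pb (memvf (npolyp N f))).
  by congr polyn; apply: eq_bigr => i _; rewrite mxE.
- rewrite lincombE => u0; apply/colP => i; rewrite mxE.
  move: (basis_free pb) => /freeP /(_ (fun i => u i 0)); apply.
  exact: val_inj.
Qed.

Lemma deriv_eq0 (f : {poly R}) : f^`() = 0 -> exists c, f = c%:P.
Proof.
move=> f0; exists f`_0; apply: size1_polyC; rewrite leqNgt; apply/negP => sf.
have [i si] : exists i, size f = i.+2 by case: (size f) sf => [|[|i]] // _; exists i.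
have := congr1 (fun g : {poly R} => g`_i) f0.
rewrite coef_deriv coef0 => /eqP; rewrite mulrn_eq0 /= => /eqP fi.
have : lead_coef f = 0 by rewrite lead_coefE si.
by move=> /eqP; rewrite lead_coef_eq0 -size_poly_eq0 si.
Qed.

Section IntegralBasis.
Variables (N : nat) (p : 'I_N -> {poly R}) (pbar : 'I_N.+1 -> {poly R}).
Hypothesis pbarP : integral_basis p pbar.

(** The hypothesis fixes pbar only through its values on [0, 1]; these already identify it with the
    primitive of p that vanishes at 0. *)
Lemma integral_basis_primitive l :
  (pbar (lift ord0 l))^`() = p l /\ (size (pbar (lift ord0 l)) <= (size (p l)).+1)%N.
Proof.
have [F Fp sF] := poly_primitive (p l).
suff pbarE : pbar (lift ord0 l) = F - F.[0]%:P.
  split; first by rewrite pbarE derivB derivC subr0.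
  rewrite pbarE (leq_trans (size_polyD _ _)) // geq_max sF size_polyN.
  exact: leq_trans (size_polyC_leq1 _) _.
apply: poly_eq_on01 => x x01; rewrite (pbarP.2 l x x01) -Fp.
by rewrite Rintegral_deriv ?hornerE //; case/andP: x01.
Qed.

(** The column is a followed by u: [unlift ord0] singles out index 0, where pbar is the constant
    1. *)
Lemma lincomb_integral (a : R) (u : 'cV[R]_N) :
  lincomb pbar (\col_i oapp (fun l => u l 0) a (unlift ord0 i)) =
  a%:P + lincomb (fun l => pbar (lift ord0 l)) u.
Proof.
rewrite /lincomb big_ord_recl mxE unlift_none /= pbarP.1 alg_polyC; congr (_ + _).
by apply: eq_bigr => l _; rewrite mxE liftK.
Qed.

Lemma col_ord0_lift (v : 'cV[R]_N.+1) :
  v = \col_i oapp (fun l => (\col_l v (lift ord0 l) 0) l 0) (v ord0 0) (unlift ord0 i).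
Proof.
by apply/colP => i; rewrite mxE; case: unliftP => [l|] -> //=; rewrite mxE.
Qed.

Lemma deriv_lincomb_lift u :
  (lincomb (fun l => pbar (lift ord0 l)) u)^`() = lincomb p u.
Proof.
rewrite deriv_lincomb; apply: eq_bigr => l _.
by rewrite (integral_basis_primitive l).1.
Qed.

(** Differentiation sends the functions pbar of positive index to p, and its kernel, the constants,
    is spanned by the remaining one. Hence expanding the derivative in p determines f up to the
    coefficient at index 0. *)
Lemma poly_basis_integral : poly_basis p -> poly_basis pbar.
Proof.
move=> [sp pspan pfree]; split=> [l|f sf|v].
- case: (unliftP ord0 l) => [i|] ->; last by rewrite pbarP.1 size_poly1.
  by rewrite (leq_trans (integral_basis_primitive i).2) ?ltnS.
- have sf' : (size f^`() <= N)%N.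
    have [->|f0] := eqVneq f 0; first by rewrite deriv0 size_poly0.
    by rewrite -ltnS (leq_trans (lt_size_deriv f0)).
  have [u fu] := pspan _ sf'.
  have [a fE] : exists a, f - lincomb (fun l => pbar (lift ord0 l)) u = a%:P.
    by apply: deriv_eq0; rewrite derivB deriv_lincomb_lift fu subrr.
  exists (\col_i oapp (fun l => u l 0) a (unlift ord0 i)).
  by rewrite lincomb_integral -fE subrK.
- rewrite (col_ord0_lift v) lincomb_integral; set u := \col_l _; set a := v ord0 0.
  move=> v0; have u0 : u = 0.
    apply: pfree; rewrite -deriv_lincomb_lift.
    by move/(congr1 deriv): v0; rewrite derivD derivC add0r deriv0.
  have a0 : a = 0.
    move: v0; rewrite u0 /lincomb big1 ?addr0; last by move=> l _; rewrite mxE scale0r.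
    by move=> /eqP; rewrite polyC_eq0 => /eqP.
  apply/colP => i; rewrite !mxE a0; case: unliftP => [l|] _ //=.
  by rewrite u0 mxE.
Qed.

End IntegralBasis.

Lemma weighted_evalmxE (q d : nat) (x w : 'I_q -> R) (e : 'I_d -> {poly R}) u i :
  (sqrtdiag w *m evalmx x e *m u) i 0 = Num.sqrt (w i) * (lincomb e u).[x i].
Proof.
rewrite -mulmxA mul_diag_mx !mxE; congr (_ * _).
by rewrite /lincomb horner_sum; apply: eq_bigr => l _; rewrite !mxE hornerZ mulrC.
Qed.

(** The square of a polynomial of size at most r has size at most [r.*2.-1], so the quadrature is
    exact on it; positive weights are the squares of their roots. *)
Lemma enorm_quadrature (D q d r : nat) (x w : 'I_q -> R) (e : 'I_d -> {poly R}) u :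
  (r.*2.-1 <= D.+1)%N -> (forall l, (size (e l) <= r)%N) ->
  (forall i, 0 < w i) -> quadrature_exact D x w ->
  enorm (sqrtdiag w *m evalmx x e *m u) ^+ 2 =
  \int[lebesgue_measure]_(s in `[0, 1]) (lincomb e u ^+ 2).[s].
Proof.
move=> rD er w0 ->; last first.
  rewrite expr2 (leq_trans (size_polyMleq _ _)) // (leq_trans _ rD) //.
  rewrite -!subn1 leq_sub2r // -addnn.
  by apply: leq_add; exact: size_lincomb.
rewrite enorm_sqrE; apply: eq_bigr => i _.
by rewrite weighted_evalmxE exprMn sqr_sqrtr ?ltW // horner_exp.
Qed.

End PolynomialBases.

(** * Euclidean norms of stacked vectors and of tensor products with the identity *)

Section BlockNorms.
Variable R : realType.

Lemma enorm_mxcol (n : nat) (r : 'I_n -> nat) (C : forall j, 'cV[R]_(r j)) :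
  enorm (\mxcol_j C j) ^+ 2 = \sum_j enorm (C j) ^+ 2.
Proof.
rewrite enorm_sqr /bform mulmx1 tr_mxcol mul_mxrow_mxcol summxE.
by apply: eq_bigr => j _; rewrite enorm_sqr /bform mulmx1.
Qed.

Lemma enorm_col_mx (q r : nat) (x : 'cV[R]_q) (y : 'cV[R]_r) :
  enorm (col_mx x y) ^+ 2 = enorm x ^+ 2 + enorm y ^+ 2.
Proof.
by rewrite !enorm_sqr /bform !mulmx1 tr_col_mx mul_row_col mxE.
Qed.

Lemma sum_mxtens (k q : nat) (F : 'I_(k * q) -> R) :
  \sum_i F i = \sum_a \sum_l F (mxtens_index (a, l)).
Proof.
rewrite pair_bigA (reindex (@mxtens_index k q)) /=; last first.
  by exists (@mxtens_unindex k q) => i _; [exact: mxtens_indexK|exact: mxtens_unindexK].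
by apply: eq_bigr => -[a l].
Qed.

Lemma enorm_tens1mx (k q r : nat) (M : 'M[R]_(q, r)) (u : 'cV[R]_(k * r)) :
  enorm (1%:M *t M *m u) ^+ 2 =
  \sum_(a < k) enorm (M *m \col_l u (mxtens_index (a, l)) 0) ^+ 2.
Proof.
rewrite enorm_sqrE sum_mxtens; apply: eq_bigr => a _; rewrite enorm_sqrE.
apply: eq_bigr => i _; congr (_ ^+ 2); rewrite !mxE sum_mxtens (bigD1 a) //=.
rewrite [X in _ + X]big1 ?addr0 => [|b ba].
  by apply: eq_bigr => l _; rewrite tensmxE !mxE eqxx mul1r.
by rewrite big1 // => l _; rewrite tensmxE !mxE eq_sym (negPf ba) !mul0r.
Qed.

End BlockNorms.

(** * Blocks of the coefficient vector, and bijectivity of the representation map *)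

Section Coefficients.
Variables (R : realType) (n k m N : nat).
Implicit Types c : 'cV[R]_(coefdim n k m N).

Definition coefdcol c j a : 'cV[R]_N.+1 := \col_l coefd c j a l.
Definition coefacol c j a : 'cV[R]_N := \col_l coefa c j a l.

Lemma coefcolP c c' :
  (forall j a, coefdcol c j a = coefdcol c' j a) ->
  (forall j a, coefacol c j a = coefacol c' j a) -> c = c'.
Proof.
move=> cd ca; apply/mxcolP => j; rewrite -/(coefblock c j) -/(coefblock c' j).
rewrite -[coefblock c j]vsubmxK -[coefblock c' j]vsubmxK; congr col_mx.
  apply/colP => i; case: (mxtens_indexP i) => a l.
  by have /colP /(_ l) := cd j a; rewrite [LHS]mxE [RHS]mxE.
apply/colP => i; case: (mxtens_indexP i) => a l.
by have /colP /(_ l) := ca j a; rewrite [LHS]mxE [RHS]mxE.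
Qed.

Lemma coefcol_surj (u : 'I_n -> 'I_k -> 'cV[R]_N.+1)
    (v : 'I_n -> 'I_(m - k) -> 'cV[R]_N) :
  exists c, (forall j a, coefdcol c j a = u j a) /\
            (forall j a, coefacol c j a = v j a).
Proof.
pose C (j : 'I_n) : 'cV[R]_(k * N.+1 + (m - k) * N) := col_mx
  (\col_i u j (mxtens_unindex i).1 (mxtens_unindex i).2 0)
  (\col_i v j (mxtens_unindex i).1 (mxtens_unindex i).2 0).
pose c : 'cV[R]_(coefdim n k m N) :=
  @mxcol R n (fun _ : 'I_n => blocksize k m N) 1 C.
have cE j : coefblock c j = C j by rewrite /coefblock mxcolK.
exists c; split=> j a; apply/colP => l; rewrite mxE.
  by rewrite /coefd cE /C col_mxKu mxE mxtens_indexK.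
by rewrite /coefa cE /C col_mxKd mxE mxtens_indexK.
Qed.

Variables (t : nat -> R) (p : 'I_N -> {poly R}) (pbar : 'I_N.+1 -> {poly R}).
Variables (sbar gbar : 'I_N.+1 -> R) (s g : 'I_N -> R).

Local Notation GVbar := (sqrtdiag gbar *m evalmx sbar pbar).
Local Notation GVring :=
  (sqrtdiag gbar *m evalmx sbar (fun l => (pbar l)^`())).
Local Notation GV := (sqrtdiag g *m evalmx s p).

Lemma enorm_Umx c :
  enorm (@Umx R n k m N t p pbar sbar gbar s g *m c) ^+ 2 =
  \sum_(j < n)
    (\sum_a (step t j `^ (3 / 2)) ^+ 2 * enorm (GVbar *m coefdcol c j a) ^+ 2 +
     \sum_a (step t j `^ (1 / 2)) ^+ 2 * enorm (GV *m coefacol c j a) ^+ 2).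
Proof.
rewrite -[in LHS](submxcolK c) /Umx mul_mxdiag_mxcol enorm_mxcol.
apply: eq_bigr => j _; rewrite -/(coefblock c j) -[coefblock c j]vsubmxK.
rewrite /Ublock mul_block_col !mul0mx addr0 add0r enorm_col_mx !enorm_tens1mx.
by congr (_ + _); apply: eq_bigr => a _;
  rewrite -scalemxAl enormZ exprMn real_normK ?num_real.
Qed.

Lemma enorm_Uhatmx c :
  enorm (@Uhatmx R n k m N t p pbar sbar gbar s g *m c) ^+ 2 =
  \sum_(j < n)
    (\sum_a ((step t j `^ (3 / 2)) ^+ 2 * enorm (GVbar *m coefdcol c j a) ^+ 2 +
             (step t j `^ (1 / 2)) ^+ 2 * enorm (GVring *m coefdcol c j a) ^+ 2) +
     \sum_a (step t j `^ (1 / 2)) ^+ 2 * enorm (GV *m coefacol c j a) ^+ 2).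
Proof.
rewrite -[in LHS](submxcolK c) /Uhatmx mul_mxblock_mxrow enorm_mxcol.
apply: eq_bigr => j _; rewrite (bigD1 j) //= eqxx big1 ?addr0; last first.
  by move=> i ij; rewrite eq_sym (negPf ij) mul0mx.
rewrite -/(coefblock c j) -[coefblock c j]vsubmxK.
rewrite /Uhatblock mul_block_col !mul0mx addr0 add0r enorm_col_mx !enorm_tens1mx.
congr (_ + _); apply: eq_bigr => a _; last first.
  by rewrite -scalemxAl enormZ exprMn real_normK ?num_real.
by rewrite mul_col_mx enorm_col_mx -!scalemxAl !enormZ !exprMn !real_normK ?num_real.
Qed.

(** The factor h is moved inside the rescaling, so that each piece is the rescaling of a single
    polynomial on [0, 1]. *)
Lemma reprmap_inl c j a : reprmap t p pbar c j (inl a) =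
  rescale t j (step t j *: lincomb pbar (coefdcol c j a)).
Proof.
rewrite /= /rescale comp_polyZ raddf_sum scaler_sumr; apply: eq_bigr => l _.
by rewrite /= comp_polyZ mxE !scalerA mulrC.
Qed.

Lemma reprmap_inr c j a : reprmap t p pbar c j (inr a) =
  rescale t j (lincomb p (coefacol c j a)).
Proof.
rewrite /= /rescale raddf_sum; apply: eq_bigr => l _.
by rewrite /= comp_polyZ mxE.
Qed.

Hypothesis t_incr : forall j, (j < n)%N -> t j < t j.+1.
Hypotheses (pP : poly_basis p) (pbarP : poly_basis pbar).

Lemma reprmap_inj : injective (reprmap t p pbar : _ -> pieces R n k m).
Proof.
have lincombI q (e : 'I_q -> {poly R}) : poly_basis e -> injective (lincomb e).
  move=> [_ _ efree] u v uv; apply/eqP; rewrite -subr_eq0; apply/eqP/efree.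
  transitivity (lincomb e u - lincomb e v); last by rewrite uv subrr.
  by rewrite -sumrB; apply: eq_bigr => l _; rewrite !mxE scalerBl.
move=> c c' cc'; apply: coefcolP => j a.
- have tj := t_incr (ltn_ord j).
  have := congr1 (fun x : pieces R n k m => x j (inl a)) cc'.
  rewrite !reprmap_inl => /(can_inj (rescaleK tj)).
  have hN0 : step t j != 0 by rewrite gt_eqF // subr_gt0.
  by move=> /(scalerI hN0) /lincombI; apply.
- have tj := t_incr (ltn_ord j).
  have := congr1 (fun x : pieces R n k m => x j (inr a)) cc'.
  by rewrite !reprmap_inr => /(can_inj (rescaleK tj)) /lincombI; apply.
Qed.

Lemma range_reprmap :
  @Xpi R n k m N = range (reprmap t p pbar : _ -> pieces R n k m).
Proof.
have [sp pspan _] := pP; have [spbar pbarspan _] := pbarP.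
apply/seteqP; split => [x xX|_ [c _ <-] j]; last first.
  split=> a; rewrite ?reprmap_inl ?reprmap_inr size_rescale ?t_incr //.
    by rewrite (leq_trans (size_scale_leq _ _)) // size_lincomb.
  exact: size_lincomb.
(* Undoing the substitution preserves degrees, so every piece expands in the basis on [0, 1];
   [choice] collects all coefficient columns before they are assembled into c. *)
have /choice [u uP] : forall ja : 'I_n * 'I_k, exists u : 'cV[R]_N.+1,
    x ja.1 (inl ja.2) = rescale t ja.1 (step t ja.1 *: lincomb pbar u).
  move=> [j a] /=; have tj := t_incr (ltn_ord j).
  have hN0 : step t j != 0 by rewrite gt_eqF // subr_gt0.
  have [|u uE] := pbarspan ((step t j)^-1 *: unscale t j (x j (inl a))).
    by rewrite (leq_trans (size_scale_leq _ _)) // size_unscale // (xX j).1.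
  by exists u; rewrite -uE scalerA mulfV // scale1r unscaleK.
have /choice [v vP] : forall ja : 'I_n * 'I_(m - k), exists v : 'cV[R]_N,
    x ja.1 (inr ja.2) = rescale t ja.1 (lincomb p v).
  move=> [j a] /=; have tj := t_incr (ltn_ord j).
  have [|v vE] := pspan (unscale t j (x j (inr a))).
    by rewrite size_unscale // (xX j).2.
  by exists v; rewrite -vE unscaleK.
have [c [cu cv]] := coefcol_surj (fun j a => u (j, a)) (fun j a => v (j, a)).
exists c => //; apply/funext => j; apply/funext => -[a|a].
  by rewrite reprmap_inl cu (uP (j, a)).
by rewrite reprmap_inr cv (vP (j, a)).
Qed.

End Coefficients.

(** * Function norms as Euclidean norms, and injectivity of the two matrices *)

Section NormIdentities.
Variables (R : realType) (t : nat -> R).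

Lemma sqint_rescale j (f : {poly R}) : t j < t j.+1 ->
  sqint t j (rescale t j f) =
  step t j * \int[lebesgue_measure]_(s in `[0, 1]) (f ^+ 2).[s].
Proof.
move=> tj; rewrite -Rintegral_rescale // /sqint; apply: eq_Rintegral => s _.
by rewrite real_normK ?num_real // !horner_rescale horner_exp.
Qed.

Lemma H1int_rescale j (f : {poly R}) : t j < t j.+1 ->
  \int[lebesgue_measure]_(s in `[t j, t j.+1])
    (`|(rescale t j f).[s]| ^+ 2 + `|(rescale t j f)^`().[s]| ^+ 2) =
  step t j * \int[lebesgue_measure]_(s in `[0, 1]) (f ^+ 2).[s] +
  (step t j)^-1 * \int[lebesgue_measure]_(s in `[0, 1]) (f^`() ^+ 2).[s].
Proof.
move=> tj; have hN0 : step t j != 0 by rewrite gt_eqF // subr_gt0.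
(* Both squares are merged into the rescaling of one polynomial; the weight h^(-2) comes from
   differentiating the rescaled piece. *)
transitivity (\int[lebesgue_measure]_(s in `[t j, t j.+1])
    (rescale t j (f ^+ 2 + (step t j) ^- 2 *: f^`() ^+ 2)).[s]).
  apply: eq_Rintegral => s _; rewrite deriv_rescale // !real_normK ?num_real //.
  by rewrite hornerZ !horner_rescale hornerD hornerZ !horner_exp exprMn exprVn.
rewrite Rintegral_rescale // Rintegral_polyD ?ler01 // Rintegral_polyZ ?ler01 //.
by rewrite mulrDr mulrA; congr (_ + _ * _); field.
Qed.

Lemma powR_half_sqr (h : R) q : 0 < h -> (h `^ (q%:R / 2)) ^+ 2 = h ^+ q.
Proof.
move=> h0; rewrite -powR_mulrn ?powR_ge0 // -powRrM divfK ?pnatr_eq0 //.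
by rewrite powR_mulrn // ltW.
Qed.

Variables (n k m N : nat) (p : 'I_N -> {poly R}) (pbar : 'I_N.+1 -> {poly R}).
Variables (sbar gbar : 'I_N.+1 -> R) (s g : 'I_N -> R).
Hypotheses (N_gt0 : (0 < N)%N) (t_incr : forall j, (j < n)%N -> t j < t j.+1).
Hypotheses (sp : forall l, (size (p l) <= N)%N).
Hypotheses (spbar : forall l, (size (pbar l) <= N.+1)%N).
Hypotheses (gbar0 : forall i, 0 < gbar i) (g0 : forall i, 0 < g i).
Hypotheses (qbar : quadrature_exact (2 * N) sbar gbar).
Hypotheses (q : quadrature_exact (2 * N - 2) s g).
Implicit Types c : 'cV[R]_(coefdim n k m N).

Lemma quadrature_pbar u : enorm (sqrtdiag gbar *m evalmx sbar pbar *m u) ^+ 2 =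
  \int[lebesgue_measure]_(s in `[0, 1]) (lincomb pbar u ^+ 2).[s].
Proof.
by apply: (enorm_quadrature _ (r := N.+1) _ _ gbar0 qbar) => //; rewrite -muln2; lia.
Qed.

Lemma quadrature_deriv_pbar u :
  enorm (sqrtdiag gbar *m evalmx sbar (fun l => (pbar l)^`()) *m u) ^+ 2 =
  \int[lebesgue_measure]_(s in `[0, 1]) ((lincomb pbar u)^`() ^+ 2).[s].
Proof.
rewrite deriv_lincomb.
apply: (enorm_quadrature _ (r := N.+1) _ _ gbar0 qbar) => [|l].
  by rewrite -muln2; lia.
exact: leq_trans (size_poly _ _) (leq_trans (leq_pred _) (spbar l)).
Qed.

Lemma quadrature_p u : enorm (sqrtdiag g *m evalmx s p *m u) ^+ 2 =
  \int[lebesgue_measure]_(s in `[0, 1]) (lincomb p u ^+ 2).[s].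
Proof.
by apply: (enorm_quadrature _ (r := N) _ _ g0 q) => //; rewrite -muln2; lia.
Qed.

Lemma L2norm_reprmap c :
  L2norm t (reprmap t p pbar c : pieces R n k m) =
  enorm (Umx t p pbar sbar gbar s g *m c).
Proof.
rewrite -[RHS]ger0_norm ?enorm_ge0 // -sqrtr_sqr enorm_Umx; congr Num.sqrt.
apply: eq_bigr => j _; have tj := t_incr (ltn_ord j).
have h0 : 0 < step t j by rewrite subr_gt0.
rewrite big_sumType; congr (_ + _); apply: eq_bigr => a _.
  rewrite reprmap_inl sqint_rescale // quadrature_pbar.
  (* Here h^3 = h * h^2: one h from the substitution, h^2 from the square of the factor in
     pbar_ji. *)
  by rewrite powR_half_sqr // exprZn Rintegral_polyZ ?ler01 // mulrA -exprS.
by rewrite reprmap_inr sqint_rescale // quadrature_p (powR_half_sqr 1).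
Qed.

Lemma H1norm_reprmap c :
  H1norm t (reprmap t p pbar c : pieces R n k m) =
  enorm (Uhatmx t p pbar sbar gbar s g *m c).
Proof.
rewrite -[RHS]ger0_norm ?enorm_ge0 // -sqrtr_sqr enorm_Uhatmx; congr Num.sqrt.
apply: eq_bigr => j _; have tj := t_incr (ltn_ord j).
have h0 : 0 < step t j by rewrite subr_gt0.
congr (_ + _); apply: eq_bigr => a _.
  rewrite reprmap_inl H1int_rescale // quadrature_pbar quadrature_deriv_pbar.
  rewrite (powR_half_sqr 3) // (powR_half_sqr 1) // derivZ !exprZn.
  rewrite !Rintegral_polyZ ?ler01 //; congr (_ + _); rewrite mulrA.
    by rewrite -exprS.
  (* For the derivative the weight h^(-1) meets the same h^2 and leaves h, the square of h^(1/2). *)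
  by congr (_ * _); rewrite expr2 mulrA mulVf ?gt_eqF // mul1r.
by rewrite reprmap_inr sqint_rescale // quadrature_p (powR_half_sqr 1).
Qed.

Hypotheses (sbar_mono : {homo sbar : i j / (i < j)%N >-> i < j}).
Hypotheses (s_mono : {homo s : i j / (i < j)%N >-> i < j}).
Hypotheses (pP : poly_basis p) (pbarP : poly_basis pbar).

(** A polynomial of size at most r that vanishes at r distinct nodes is zero. Arguing at the nodes
    avoids having to prove that a polynomial of zero L^2 norm vanishes. *)
Lemma enorm_evalmx_eq0 (r : nat) (x w : 'I_r -> R) (e : 'I_r -> {poly R}) u :
  {homo x : i j / (i < j)%N >-> i < j} -> (forall i, 0 < w i) ->
  poly_basis e -> enorm (sqrtdiag w *m evalmx x e *m u) ^+ 2 = 0 -> u = 0.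
Proof.
move=> xmono w0 [se _ efree] /eqP; rewrite sqrf_eq0 enorm_eq0 => /eqP u0.
apply/efree/(poly_eq0_nodes xmono); first exact: size_lincomb.
move=> i; have /colP /(_ i) := u0.
rewrite weighted_evalmxE mxE => /eqP.
by rewrite mulf_eq0 sqrtr_eq0 leNgt w0 => /eqP.
Qed.

Lemma psumr_block_eq0 (X : 'I_n -> 'I_k -> R) (Y : 'I_n -> 'I_(m - k) -> R) :
  (forall j a, 0 <= X j a) -> (forall j a, 0 <= Y j a) ->
  \sum_j (\sum_a X j a + \sum_a Y j a) = 0 ->
  (forall j a, X j a = 0) /\ (forall j a, Y j a = 0).
Proof.
move=> X0 Y0 sum0; have sX j : 0 <= \sum_a X j a by exact: sumr_ge0.
have sY j : 0 <= \sum_a Y j a by exact: sumr_ge0.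
have XY j : (\sum_a X j a == 0) && (\sum_a Y j a == 0).
  rewrite -paddr_eq0 //; apply/eqP; move: j (erefl true).
  by apply: psumr_eq0P sum0 => j _; exact: addr_ge0.
split=> j a; case/andP: (XY j) => /eqP Xj /eqP Yj.
  by apply: (psumr_eq0P _ Xj).
by apply: (psumr_eq0P _ Yj).
Qed.

Lemma powR_sqr_gt0 j r : (j < n)%N -> 0 < (step t j `^ r) ^+ 2.
Proof. by move=> /t_incr tj; rewrite exprn_gt0 // powR_gt0 // subr_gt0. Qed.

Lemma reprmap_coef_eq0 c :
  (forall (j : 'I_n) a,
     enorm (sqrtdiag gbar *m evalmx sbar pbar *m coefdcol c j a) ^+ 2 = 0) ->
  (forall (j : 'I_n) a,
     enorm (sqrtdiag g *m evalmx s p *m coefacol c j a) ^+ 2 = 0) ->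
  c = 0.
Proof.
move=> cd ca; apply: coefcolP => j a.
  rewrite (enorm_evalmx_eq0 sbar_mono gbar0 pbarP (cd j a)).
  by apply/colP => l; rewrite [RHS]mxE /coefd /coefa /coefblock submxcol0 !mxE.
rewrite (enorm_evalmx_eq0 s_mono g0 pP (ca j a)).
by apply/colP => l; rewrite [RHS]mxE /coefd /coefa /coefblock submxcol0 !mxE.
Qed.

Lemma Umx_inj c : Umx t p pbar sbar gbar s g *m c = 0 -> c = 0.
Proof.
move=> Uc0; have := enorm_Umx t p pbar sbar gbar s g c.
rewrite Uc0 enorm0 expr0n => /esym /psumr_block_eq0.
case=> [j a|j a|cd ca]; try exact: mulr_ge0 (sqr_ge0 _) (sqr_ge0 _).
apply: reprmap_coef_eq0 => j a.
  move/eqP: (cd j a); rewrite mulf_eq0 gt_eqF ?powR_sqr_gt0 //=; exact: eqP.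
by move/eqP: (ca j a); rewrite mulf_eq0 gt_eqF ?powR_sqr_gt0 //= => /eqP.
Qed.

(** Uhat contains the value rows up to the same factors as U, and these alone force c = 0; the
    nonnegative derivative terms are split off and dropped. *)
Lemma Uhatmx_inj c : Uhatmx t p pbar sbar gbar s g *m c = 0 -> c = 0.
Proof.
move=> Uc0; have := enorm_Uhatmx t p pbar sbar gbar s g c.
rewrite Uc0 enorm0 expr0n => /esym /psumr_block_eq0.
case=> [j a|j a|cd ca]; last first.
- apply: reprmap_coef_eq0 => j a; last first.
    by move/eqP: (ca j a); rewrite mulf_eq0 gt_eqF ?powR_sqr_gt0 //= => /eqP.
  move/eqP: (cd j a); rewrite paddr_eq0 ?(mulr_ge0 (sqr_ge0 _) (sqr_ge0 _)) //.
  by rewrite mulf_eq0 gt_eqF ?powR_sqr_gt0 //= => /andP[/eqP].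
- exact: mulr_ge0 (sqr_ge0 _) (sqr_ge0 _).
- by apply: addr_ge0; exact: mulr_ge0 (sqr_ge0 _) (sqr_ge0 _).
Qed.

End NormIdentities.

Theorem theorem2 (R : realType) (a b : R) (k m N n : nat) (t : nat -> R)
    (p : N.-tuple {poly_N R}) (pbar : 'I_N.+1 -> {poly R})
    (sbar gbar : 'I_N.+1 -> R) (s g : 'I_N -> R)
    (P : 'I_N -> {poly R} := fun i => polyn (tnth p i))
    (Rep : 'cV[R]_(coefdim n k m N) -> pieces R n k m := reprmap t P pbar)
    (RepV : pieces R n k m -> 'cV[R]_(coefdim n k m N) := reprmapV t P pbar)
    (U := @Umx R n k m N t P pbar sbar gbar s g)
    (Uhat := @Uhatmx R n k m N t P pbar sbar gbar s g) :
    a < b -> (0 < k)%N -> (k < m)%N -> (1 <= N)%N ->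
    t 0%N = a -> t n = b -> (forall j, (j < n)%N -> t j < t j.+1) ->
    basis_of {:{poly_N R}} p ->
    integral_basis P pbar ->
    (forall i, 0 <= sbar i <= 1) -> {homo sbar : i j / (i < j)%N >-> i < j} ->
    (forall i, 0 < gbar i) -> quadrature_exact (2 * N) sbar gbar ->
    (forall i, 0 <= s i <= 1) -> {homo s : i j / (i < j)%N >-> i < j} ->
    (forall i, 0 < g i) -> quadrature_exact (2 * N - 2) s g ->
  [/\ opnorm setT (@enorm R _) (L2norm t) Rep = sigma_max U,
      opnorm (Xpi N) (L2norm t) (@enorm R _) RepV = (sigma_min U)^-1,
      opnorm setT (@enorm R _) (H1norm t) Rep = sigma_max Uhat
    & opnorm (Xpi N) (H1norm t) (@enorm R _) RepV = (sigma_min Uhat)^-1].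
Proof.
move=> ab k0 km N0 ta tb tincr pb pbarI _ sbar_mono gbar0 qbar _ s_mono g0 q.
have pP : poly_basis P by exact: poly_basis_npoly.
have pbarP : poly_basis pbar by exact: poly_basis_integral pbarI pP.
have [sp _ _] := pP; have [spbar _ _] := pbarP.
(* With n = 0 the end points a and b would coincide. A nonempty mesh together with 0 < k gives a
   coefficient space of positive dimension, hence unit vectors. *)
have n0 : (0 < n)%N.
  by rewrite lt0n; apply: contraTneq ab => n0; rewrite -ta -tb n0 ltxx.
have d0 : (0 < coefdim n k m N)%N.
  by rewrite coefdimE // muln_gt0 n0 addn_gt0 k0 orbT.
(* The partial inverse chooses some preimage; injectivity leaves only one, and [rangeRep] then makes
   it the inverse on all of [Xpi N]. *)
have RepK : cancel Rep RepV.
  move=> c; apply: pinvKV; rewrite ?inE // => x y _ _.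
  exact: (reprmap_inj tincr pP pbarP).
have rangeRep : Xpi N = range Rep by exact: range_reprmap.
have L2P c : L2norm t (Rep c) = enorm (U *m c) by exact: L2norm_reprmap.
have H1P c : H1norm t (Rep c) = enorm (Uhat *m c) by exact: H1norm_reprmap.
split; [exact: opnorm_sigma_max | apply: opnorm_sigma_min => //
       |exact: opnorm_sigma_max | apply: opnorm_sigma_min => //].
- exact: (Umx_inj tincr gbar0 g0 sbar_mono s_mono pP pbarP).
- exact: (Uhatmx_inj tincr gbar0 g0 sbar_mono s_mono pP pbarP).
Qed.
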